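(* Let $\mathcal H=\bigoplus_n\mathcal H_{C_n}$ be a finite-dimensional complex Hilbert space decomposed as an orthogonal direct sum, and let $\Pi_n$ be the orthogonal projector onto $\mathcal H_{C_n}$. Let $\{\Lambda_t\}_{t\ge0}$ with $\Lambda_t=e^{\mathcal L t}$ be a semigroup of completely positive trace-preserving maps on $L(\mathcal H)$ with generator $\mathcal L$, which preserves the algebra of block-diagonal operators $\bigoplus_n L(\mathcal H_{C_n})$ (that is, $\Lambda_t$ maps this algebra into itself for all $t\ge 0$). Then the generator acts on the states of the clock, i.e. on every block-diagonal state $\rho=\bigoplus_n p_n\rho_n$, as $$\mathcal L[\rho]=-i[H,\rho]+\sum_j\gamma_j\,\mathcal D_{L_j}[\rho],$$ with rates $\gamma_j\ge0$, where the Hamiltonian $H$ is Hermitian and block-diagonal, $$H=\bigoplus_n H^{(n)}_{C_n},$$ and each jump operator $L_j$ connects only a single block to a single other block (possibly the same): for every $j$ there is a pair of indices $m,n$ (possibly equal) such that $$L_j=\Pi_m L_j\Pi_n .$$ Here $H$, $\gamma_j$, $L_j$ do not depend on $\rho$.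
   Context: $L(\mathcal H)$ is the space of linear operators on $\mathcal H$. The dissipator is $\mathcal D_X[\rho]=X\rho X^\dagger-\frac12\{X^\dagger X,\rho\}$, with $\{\cdot,\cdot\}$ the anticommutator. A minimal ticking clock is a quantum system with Hilbert space $\mathcal H=\bigoplus_n\mathcal H_{C_n}$ (the index $n$ is called the register index and $\mathcal H_{C_n}$ the clockwork spaces), whose states at all times are block-diagonal, $\rho_t=\bigoplus_n p_{n|t}\,\rho_{n|t}$ with $p_{n|t}$ a probability distribution in $n$ and $\rho_{n|t}$ density matrices on $\mathcal H_{C_n}$, and whose time measurement is given by the projectors $\Pi_n$. The clock is self-timed if its dynamics are given by a semigroup of completely positive trace-preserving maps, $\rho_t=\Lambda_t[\rho_0]$, $\Lambda_t=e^{\mathcal Lt}$. The allowed dynamics for a ticking clock are those preserving the block-diagonal algebra. *)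

(* Defs.v *)
From mathcomp Require Export all_boot all_order all_algebra.
From mathcomp Require Export all_classical all_reals all_analysis.
From mathcomp.real_closed Require Export complex.
Export Order.TTheory GRing.Theory Num.Theory.
Export numFieldNormedType.Exports.

Set Implicit Arguments.
Unset Strict Implicit.
Unset Printing Implicit Defensive.

Local Open Scope classical_set_scope.
Local Open Scope ring_scope.
Local Open Scope sesquilinear_scope.
Local Open Scope complex_scope.

(* The Hilbert space is C^d with its standard inner product <u, v> = u^* v;
   operators are d x d matrices acting on column vectors. *)

Section Operators.
Variable C : numClosedFieldType.

(* On a numClosedFieldType, [0 <= z] means that z is real and nonnegative. *)
Definition psdmx n (A : 'M[C]_n) : Prop :=
  A \is hermsymmx /\ forall v : 'cV[C]_n, 0 <= (v^t* *m A *m v) 0 0.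

Definition density_matrix n (rho : 'M[C]_n) : Prop :=
  psdmx rho /\ \tr rho = 1.

Definition commutator n (A B : 'M[C]_n) : 'M[C]_n := A *m B - B *m A.

Definition anticommutator n (A B : 'M[C]_n) : 'M[C]_n := A *m B + B *m A.

Definition dissipator n (X rho : 'M[C]_n) : 'M[C]_n :=
  X *m rho *m X^t* - 2^-1 *: anticommutator (X^t* *m X) rho.

(* An element of M_k (x) L(C^d) is a k x k block matrix with blocks X i j in
   L(C^d), on which id_k (x) Phi acts by applying Phi to every block. *)
Definition completely_positive d (Phi : 'M[C]_d -> 'M[C]_d) : Prop :=
  forall (k : nat) (X : 'I_k -> 'I_k -> 'M[C]_d),
    psdmx (\mxblock_(i < k, j < k) X i j) ->
    psdmx (\mxblock_(i < k, j < k) Phi (X i j)).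

Definition trace_preserving d (Phi : 'M[C]_d -> 'M[C]_d) : Prop :=
  forall X, \tr (Phi X) = \tr X.

Definition orthogonal_decomposition N d
    (V : 'I_N -> {vspace 'cV[C]_d}) : Prop :=
  (\sum_n V n)%VS = fullv /\
  forall m n, m != n ->
    forall u v, u \in V m -> v \in V n -> u^t* *m v = 0.

Definition orthogonal_projector d
    (V : {vspace 'cV[C]_d}) (P : 'M[C]_d) : Prop :=
  [/\ P \is hermsymmx, P *m P = P & forall v, v \in V <-> P *m v = v].

(* The operator direct sum (+)_n X_n; each X_n in L(H_n) is represented by its
   extension by zero to the whole space, i.e. by X_n = P_n X_n P_n. *)
Definition block_diagonal N d
    (P : 'I_N -> 'M[C]_d) (X : 'M[C]_d) : Prop :=
  exists Xn : 'I_N -> 'M[C]_d,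
    (forall n, Xn n = P n *m Xn n *m P n) /\ X = \sum_n Xn n.

End Operators.

(* Phi = exp (t L): the exponential series of the superoperator t L, applied
   to any operator X, converges to Phi X. *)
Definition is_exp (K : numFieldType) d (L : 'M[K]_d -> 'M[K]_d) (t : K)
    (Phi : 'M[K]_d -> 'M[K]_d) : Prop :=
  forall X : 'M[K]_d,
    series (fun k : nat => (t ^+ k / k`!%:R) *: iter k L X) @ \oo --> Phi X.

Definition cptp_semigroup (R : realType) d
    (Lambda : R -> {linear 'M[R[i]]_d -> 'M[R[i]]_d}) : Prop :=
  [/\ forall X, Lambda 0 X = X,
      forall s t, 0 <= s -> 0 <= t ->
        forall X, Lambda (s + t) X = Lambda s (Lambda t X),
      forall t, 0 <= t -> completely_positive (Lambda t) &
      forall t, 0 <= t -> trace_preserving (Lambda t)].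

(* Main.v *)
From HB Require Import structures.
Require Import Defs.

(* The difference quotients (Lambda_t - id)/t converge to L as t -> 0+. By
   complete positivity the Choi matrix of Lambda_t is psd, and that of id is
   w w^* (w the maximally entangled vector); hence the Choi matrix of L is
   hermitian and nonnegative on the orthogonal of w. Such a matrix is of the
   form sum_k u_k u_k^* + a w^* + w a^*, which read back blockwise says
   L X = sum_k K_k X K_k^* + A X + X A^*, and trace preservation gives
   sum_k K_k^* K_k + A + A^* = 0. For block-diagonal rho, L rho is
   block-diagonal, so it equals its own pinching sum_m P_m (L rho) P_m; since
   rho = sum_n P_n rho P_n, the pinching replaces the K_k by the single-block
   operators P_m K_k P_n and A by the block-diagonal sum_n P_n A P_n, and
   preserves the trace relation. *)

Set Implicit Arguments.
Unset Strict Implicit.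
Unset Printing Implicit Defensive.

Local Open Scope ring_scope.
Local Open Scope sesquilinear_scope.

(** * Hermitian and positive semidefinite matrices *)

Section HermitianForms.
Variable C : numClosedFieldType.

Lemma ctmx_mul m n p (A : 'M[C]_(m, n)) (B : 'M[C]_(n, p)) :
  (A *m B)^t* = B^t* *m A^t*.
Proof. by rewrite trmx_mul map_mxM. Qed.

Lemma ctmxB m n (A B : 'M[C]_(m, n)) : (A - B)^t* = A^t* - B^t*.
Proof. by rewrite linearB map_mxB. Qed.

Lemma ctmxZ m n a (A : 'M[C]_(m, n)) : (a *: A)^t* = a^* *: A^t*.
Proof. by rewrite linearZ map_mxZ. Qed.

Lemma ctmx_sum m n (I : finType) (F : I -> 'M[C]_(m, n)) :
  (\sum_i F i)^t* = \sum_i (F i)^t*.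
Proof. by rewrite linear_sum map_mx_sum. Qed.

Lemma hermsymmxP n (A : 'M[C]_n) : reflect (A^t* = A) (A \is hermsymmx).
Proof.
apply: (iffP (is_hermitianmxP _ _ _)); rewrite expr0 scale1r => AE;
  exact: esym AE.
Qed.

(** By the spectral theorem: each eigenvalue is the value of the form at a unit eigenvector, hence
    nonnegative, and its square root can be absorbed into that eigenvector. *)
Lemma psdmx_gram n (B : 'M[C]_n) : psdmx B ->
  exists w : 'I_n -> 'cV[C]_n, B = \sum_k w k *m (w k)^t*.
Proof.
move=> [Bh Bpos]; set U := spectralmx B; set D := spectral_diag B.
have /orthomx_spectralP BE := hermitian_normalmx Bh.
have Uu : U \is unitarymx by exact: spectral_unitarymx.
rewrite -/U -/D invmx_unitary// in BE.
have D0 k : 0 <= D 0 k.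
  have := Bpos ((row k U)^t* ); rewrite trmxCK BE !mulmxA.
  have rU : row k U *m U^t* = delta_mx 0 k.
    by rewrite -row_mul (unitarymxP Uu) row1.
  have Ur : U *m (row k U)^t* = ('e_k)^t* by rewrite -rU ctmx_mul trmxCK.
  rewrite rU -mulmxA Ur -rowE row_diag_mx -scalemxAl trmx_delta map_delta_mx.
  by rewrite mul_delta_mx !mxE !eqxx mulr1.
exists (fun k => sqrtC (D 0 k) *: (row k U)^t* ).
rewrite {1}BE mul_mx_diag.
apply/matrixP => i j; rewrite summxE mxE; apply: eq_bigr => k _.
rewrite ctmxZ trmxCK -scalemxAl -scalemxAr scalerA.
rewrite !mxE big_ord1 !mxE [(sqrtC _)^*]conj_Creal ?ger0_real ?sqrtC_ge0//.
by rewrite -expr2 sqrtCK mulrCA mulrA.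
Qed.

(* With [Q = 1 - tau w^*], where [w^* tau = 1], one has [Q v] in the orthogonal
   of [w] for all [v], and [Q^* B Q] differs from [B] by terms in [w]. *)
Lemma psd_on_orthogonal n (B : 'M[C]_n) (w : 'cV[C]_n) :
    B \is hermsymmx ->
    (forall v : 'cV[C]_n, w^t* *m v = 0 -> 0 <= (v^t* *m B *m v) 0 0) ->
  exists (u : 'I_n -> 'cV[C]_n) (a : 'cV[C]_n),
    B = \sum_k u k *m (u k)^t* + (a *m w^t* + w *m a^t* ).
Proof.
move=> Bh Bpos; have Bt := hermsymmxP _ Bh.
have [w0|w0] := eqVneq w 0.
  have [|u ->] := @psdmx_gram n B; last first.
    by exists u, 0; rewrite w0 !mul0mx !addr0.
  by split=> // v; apply: Bpos; rewrite w0 trmx0 map_mx0 mul0mx.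
have [tau tau1] : exists tau : 'cV[C]_n, w^t* *m tau = 1%:M.
  exists (((w^t* *m w) 0 0)^-1 *: w).
  rewrite -scalemxAr {2}[_ *m w]mx11_scalar scale_scalar_mx mulVf//.
  apply: contra_neq w0 => /eqP; rewrite mxE psumr_eq0 => [|i _]; last first.
    by rewrite !mxE mulrC mul_conjC_ge0.
  move=> /allP w0; apply/matrixP => i j; rewrite ord1 mxE.
  have := w0 i (mem_index_enum i); rewrite !mxE mulrC mul_conjC_eq0.
  by move/eqP.
pose Q := 1%:M - tau *m w^t*.
have wQ : w^t* *m Q = 0 by rewrite mulmxBr mulmx1 mulmxA tau1 mul1mx subrr.
have [|u uE] := @psdmx_gram n (Q^t* *m B *m Q).
  split; first by apply/hermsymmxP; rewrite !ctmx_mul trmxCK Bt mulmxA.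
  move=> v; have := Bpos (Q *m v).
  rewrite [w^t* *m _]mulmxA wQ mul0mx ctmx_mul !mulmxA.
  by apply.
pose s := tau^t* *m B *m tau.
have st : s^t* = s by rewrite !ctmx_mul trmxCK Bt mulmxA.
(* Expanding [Q^* B Q] leaves, besides [B] and the two cross terms, the term [w s w^*]. It is
   Hermitian, so half of it goes into [a w^*] and half into [w a^*]. *)
exists u, (B *m tau - 2^-1 *: w *m s).
rewrite -uE /Q ctmxB trmx1 map_mx1 ctmx_mul trmxCK.
rewrite ctmxB ctmx_mul -scalemxAl ctmxZ ctmx_mul st Bt.
have -> : (2^-1)^* = 2^-1 :> C by rewrite conj_Creal// rpredV realn.
rewrite !mulmxBl !mulmxBr !mul1mx !mulmx1 -!scalemxAl -!scalemxAr /s !mulmxA.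
set x := _ *m w^t*; set y := _ *m B; set z := _ *m w^t*.
rewrite [X in _ + X]addrACA -opprD -scalerDl.
have -> : 2^-1 + 2^-1 = 1 :> C by rewrite [RHS](splitr 1) !mul1r.
by rewrite scale1r -[B - x - _]addrA -opprD [x + (y - z)]addrA subrK.
Qed.

End HermitianForms.

Lemma mxtrace_mul_eq0 (K : comNzRingType) d (M : 'M[K]_d) :
  (forall X, \tr (M *m X) = 0) -> M = 0.
Proof.
move=> trM; apply/matrixP => i j; have := trM (delta_mx j i).
rewrite -(mul_delta_mx (0 : 'I_1)) mulmxA -colE mxtrace_mulC -rowE.
by rewrite /mxtrace big_ord1 !mxE.
Qed.

(** * Splitting a drift term into Hamiltonian and dissipative parts *)

Section Lindbladian.
Variables (C : numClosedFieldType) (d : nat).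

Lemma sum_dissipator (I : finType) (X : I -> 'M[C]_d) rho :
  \sum_j dissipator (X j) rho = \sum_j X j *m rho *m (X j)^t*
    - 2^-1 *: anticommutator (\sum_j (X j)^t* *m X j) rho.
Proof.
rewrite /dissipator /anticommutator big_split sumrN -scaler_sumr big_split/=.
by rewrite mulmx_suml mulmx_sumr.
Qed.

Definition hamiltonian_part (A : 'M[C]_d) := ('i / 2) *: (A - A^t* ).

Lemma hamiltonian_part_herm A : hamiltonian_part A \is hermsymmx.
Proof.
apply/hermsymmxP; rewrite ctmxZ ctmxB trmxCK rmorphM/= fmorphV/= conjCi.
by rewrite conjC_nat mulNr scaleNr -scalerN opprB.
Qed.

(** The hypothesis says that the Hermitian part of [A] is [- D / 2], hence [A = - D / 2 - i H]. The
    first summand yields the anticommutator and the second the commutator. *)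
Lemma drift_hamiltonian (A D rho : 'M[C]_d) : D + (A + A^t* ) = 0 ->
  A *m rho + rho *m A^t* =
    - ('i *: commutator (hamiltonian_part A) rho)
    - 2^-1 *: anticommutator D rho.
Proof.
move=> DA; have -> : D = - (A + A^t* ) by apply/eqP; rewrite -subr_eq0 opprK DA.
rewrite /commutator /hamiltonian_part -scalemxAl -scalemxAr -scalerBr scalerA.
have -> : 'i * ('i / 2) = - 2^-1 :> C by rewrite mulrA -expr2 sqrCi mulN1r.
rewrite scaleNr opprK /anticommutator mulNmx mulmxN -opprD scalerN opprK.
rewrite -scalerDr mulmxBl mulmxBr mulmxDl mulmxDr.
set x := A *m rho; set y := _ *m rho; set z := rho *m A; set w := rho *m _.
have -> : x - y - (z - w) + (x + y + (z + w)) = (x + w) + (x + w).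
  rewrite opprB addrACA [x + y]addrC [in X in _ + X]addrA.
  by rewrite [w - z + z]subrK [x - y + _]addrA subrK addrACA.
rewrite scalerDr -scalerDl -[LHS]scale1r; congr (_ *: _).
by rewrite [LHS](splitr 1) !mul1r.
Qed.

End Lindbladian.

(** * Pinching by an orthogonal decomposition *)

Section Pinching.
Variables (C : numClosedFieldType) (N d : nat).
Variables (V : 'I_N -> {vspace 'cV[C]_d}) (P : 'I_N -> 'M[C]_d).
Hypothesis V_dec : orthogonal_decomposition V.
Hypothesis P_proj : forall n, orthogonal_projector (V n) (P n).

Lemma projector_ct n : (P n)^t* = P n.
Proof. by have [/hermsymmxP] := P_proj n. Qed.

Lemma projector_idem n : P n *m P n = P n.
Proof. by have [] := P_proj n. Qed.

Lemma projector_mem n v : P n *m v \in V n.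
Proof. by have [_ _ ->] := P_proj n; rewrite mulmxA projector_idem. Qed.

(** As [P m] is Hermitian, entry [(i, j)] of the product is the inner product of [P m e_i] in [V m]
    with [P n e_j] in [V n]. *)
Lemma projector_ortho m n : m != n -> P m *m P n = 0.
Proof.
move=> mn; have [_ Vmn] := V_dec; apply/matrixP => i j.
have := Vmn _ _ mn _ _ (projector_mem m (delta_mx i 0))
  (projector_mem n (delta_mx j 0)).
rewrite ctmx_mul projector_ct trmx_delta map_delta_mx !mulmxA.
rewrite -[_ *m P m *m P n]mulmxA.
by rewrite -rowE -colE => /matrixP/(_ 0 0); rewrite !mxE.
Qed.

Lemma projector_sum : \sum_n P n = 1%:M.
Proof.
have [Vfull _] := V_dec.
suff PV (v : 'cV[C]_d) : (\sum_n P n) *m v = v.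
  apply/matrixP => i j; have := PV (delta_mx j 0).
  by rewrite -colE => /matrixP/(_ i 0); rewrite !mxE eqxx andbT => ->.
have : v \in (\sum_n V n)%VS by rewrite Vfull memvf.
case/memv_sumP => w wV ->; rewrite mulmx_sumr; apply: eq_bigr => n _.
have [_ _ Pn] := P_proj n; have /Pn Pw := wV n isT.
rewrite mulmx_suml (bigD1 n)//= big1 ?addr0// => m mn.
by rewrite -Pw mulmxA projector_ortho// mul0mx.
Qed.

(** The conditional expectation onto the block-diagonal algebra. *)
Definition pinch (X : 'M[C]_d) := \sum_n P n *m X *m P n.

Lemma block_diagonal_pinch X : block_diagonal P (pinch X).
Proof.
exists (fun n => P n *m X *m P n); split=> // n.
by rewrite !mulmxA projector_idem -!mulmxA projector_idem.
Qed.

Lemma block_diagonal_offdiag X m n :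
  block_diagonal P X -> m != n -> P m *m X *m P n = 0.
Proof.
move=> [Y [YE ->]] mn; rewrite mulmx_sumr mulmx_suml big1// => k _.
rewrite YE !mulmxA; have [<-|mk] := eqVneq m k.
  by rewrite -[_ *m P m *m P n]mulmxA (projector_ortho mn) mulmx0.
by rewrite projector_ortho// !mul0mx.
Qed.

Lemma offdiag_pinch X :
  (forall m n, m != n -> P m *m X *m P n = 0) -> pinch X = X.
Proof.
move=> X0; rewrite -[RHS]mul1mx -[RHS]mulmx1 -projector_sum.
rewrite !mulmx_suml; apply: eq_bigr => m _; rewrite mulmx_sumr.
by rewrite (bigD1 m)//= big1 ?addr0// => n nm; rewrite X0// eq_sym.
Qed.

Lemma pinch_id X : block_diagonal P X -> pinch X = X.
Proof.
by move=> bX; apply: offdiag_pinch => m n; exact: block_diagonal_offdiag.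
Qed.

Lemma mulmx_projector_comm X n : block_diagonal P X -> P n *m X = X *m P n.
Proof.
move=> bX; rewrite -[LHS]mulmx1 -[RHS]mul1mx -projector_sum.
rewrite mulmx_sumr !mulmx_suml.
rewrite (bigD1 n)//= [RHS](bigD1 n)//= !big1 ?addr0 ?mulmxA// => m mn;
  by rewrite ?mulmxA block_diagonal_offdiag// eq_sym.
Qed.

Lemma pinchD X Y : pinch (X + Y) = pinch X + pinch Y.
Proof.
rewrite /pinch -big_split; apply: eq_bigr => n _.
by rewrite mulmxDr mulmxDl.
Qed.

Lemma pinch_sum (I : finType) (F : I -> 'M[C]_d) :
  pinch (\sum_k F k) = \sum_k pinch (F k).
Proof.
rewrite /pinch exchange_big; apply: eq_bigr => n _.
by rewrite mulmx_sumr mulmx_suml.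
Qed.

Lemma pinch_ct X : (pinch X)^t* = pinch (X^t* ).
Proof.
rewrite ctmx_sum; apply: eq_bigr => n _.
by rewrite !ctmx_mul projector_ct mulmxA.
Qed.

(** Half of the bimodule property over the block-diagonal algebra, whose elements commute with every
    [P n]. It moves the pinching of a drift term onto its coefficient. *)
Lemma pinch_mulr X Y : block_diagonal P Y -> pinch (X *m Y) = pinch X *m Y.
Proof.
move=> bY; rewrite /pinch mulmx_suml; apply: eq_bigr => n _.
by rewrite -!mulmxA (mulmx_projector_comm n bY).
Qed.

Lemma pinch_mull X Y : block_diagonal P X -> pinch (X *m Y) = X *m pinch Y.
Proof.
move=> bX; rewrite /pinch mulmx_sumr; apply: eq_bigr => n _.
by rewrite !mulmxA (mulmx_projector_comm n bX).
Qed.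

(** The index [m] comes from the outer pinching, [n] from writing [X] as its own pinching. *)
Lemma pinch_conj K X : block_diagonal P X ->
  pinch (K *m X *m K^t* ) =
  \sum_m \sum_n (P m *m K *m P n) *m X *m (P m *m K *m P n)^t*.
Proof.
move=> bX; apply: eq_bigr => m _.
rewrite -[X in LHS]pinch_id// /pinch.
rewrite mulmx_sumr mulmx_suml mulmx_sumr mulmx_suml.
by apply: eq_bigr => n _; rewrite !ctmx_mul !projector_ct !mulmxA.
Qed.

(** Here the outer pinching supplies [n], and [m] comes from inserting the sum of the [P m] between
    [K^*] and [K]. The operators are those of [pinch_conj], so both halves of the dissipator
    match. *)
Lemma pinch_gram K :
  pinch (K^t* *m K) =
  \sum_m \sum_n (P m *m K *m P n)^t* *m (P m *m K *m P n).
Proof.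
rewrite exchange_big; apply: eq_bigr => n _.
have -> : K^t* *m K = \sum_m (P m *m K)^t* *m (P m *m K).
  have KE : K = \sum_m P m *m K by rewrite -mulmx_suml projector_sum mul1mx.
  rewrite {2}KE mulmx_sumr.
  apply: eq_bigr => m _; rewrite ctmx_mul projector_ct !mulmxA.
  by rewrite -[_ *m P m *m P m]mulmxA projector_idem.
rewrite mulmx_sumr mulmx_suml; apply: eq_bigr => m _.
by rewrite !ctmx_mul !projector_ct !mulmxA.
Qed.

End Pinching.

(** * Choi matrices and Kraus operators *)

Section Choi.
Variables (C : numClosedFieldType) (d : nat).

(** Given in block form so that [completely_positive] applies to it directly, with the matrix units
    as blocks. *)
Definition choi_mx (F : 'M[C]_d -> 'M[C]_d) : 'M[C]_(\sum_(i < d) d) :=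
  \mxblock_(i < d, j < d) F (delta_mx i j).

Definition choi_vec : 'cV[C]_(\sum_(i < d) d) :=
  \mxcol_(i < d) (delta_mx i 0 : 'cV[C]_d).

Lemma submxblock_outer (x y : 'cV[C]_(\sum_(i < d) d)) i j :
  submxblock (x *m y^t* ) i j = submxcol x i *m (submxcol y j)^t*.
Proof. by apply/matrixP => a b; rewrite !mxE !big_ord1 !mxE. Qed.

Lemma choi_mx_id : choi_mx id = choi_vec *m choi_vec^t*.
Proof.
apply/mxblockP => i j; rewrite mxblockK submxblock_outer !mxcolK.
by rewrite trmx_delta map_delta_mx mul_delta_mx.
Qed.

Lemma choi_kraus (F : {linear 'M[C]_d -> 'M[C]_d}) :
    choi_mx F \is hermsymmx ->
    (forall v : 'cV[C]_(\sum_(i < d) d),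
      choi_vec^t* *m v = 0 -> 0 <= (v^t* *m choi_mx F *m v) 0 0) ->
  exists (s : nat) (K : 'I_s -> 'M[C]_d) (A : 'M[C]_d), forall X,
    F X = \sum_k K k *m X *m (K k)^t* + (A *m X + X *m A^t* ).
Proof.
move=> Fh Fpos; have [u [a FE]] := psd_on_orthogonal Fh Fpos.
(* [M x] has the blocks of [x] as columns. Then [x y^*] is the Choi matrix of the map sending [X] to
   [M x X (M y)^*], and [choi_vec] corresponds to the identity. *)
pose M (x : 'cV[C]_(\sum_(i < d) d)) : 'M[C]_d :=
  \matrix_(b, i) submxcol x i b 0.
have ME x i : M x *m delta_mx i 0 = submxcol x i.
  by rewrite -colE; apply/matrixP => b c; rewrite (ord1 c) !mxE.
exists (\sum_(i < d) d)%N, (fun k => M (u k)), (M a).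
pose G X := \sum_k M (u k) *m X *m (M (u k))^t* + (M a *m X + X *m (M a)^t* ).
have G_linear : linear G.
  move=> c X Y; rewrite /G mulmxDr mulmxDl -scalemxAl -scalemxAr.
  under eq_bigr do rewrite mulmxDr mulmxDl -scalemxAr -scalemxAl.
  by rewrite big_split/= -scaler_sumr !scalerDr [RHS]addrACA
    [X in _ = _ + X]addrACA.
pose G' : {linear 'M[C]_d -> 'M[C]_d} :=
  HB.pack G (GRing.isLinear.Build _ _ _ _ G G_linear).
suff FG i j : F (delta_mx i j) = G' (delta_mx i j).
  move=> X; rewrite -[RHS]/(G' X) (matrix_sum_delta X) !linear_sum.
  apply: eq_bigr => i _; rewrite !linear_sum; apply: eq_bigr => j _.
  by rewrite !linearZ FG.
have -> : F (delta_mx i j) = submxblock (choi_mx F) i j by rewrite mxblockK.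
have outer (x y : 'cV[C]_(\sum_(i < d) d)) :
    submxblock (x *m y^t* ) i j = M x *m delta_mx i j *m (M y)^t*.
  rewrite submxblock_outer -!ME ctmx_mul trmx_delta map_delta_mx mulmxA.
  by rewrite -[M x *m _ *m _]mulmxA mul_delta_mx.
have choi_vecM : M choi_vec = 1%:M.
  by apply/matrixP => b c; rewrite mxE mxcolK !mxE eqxx andbT.
rewrite FE submxblockD submxblock_sum submxblockD !outer choi_vecM.
rewrite !mul1mx trmx1 map_mx1 !mulmx1 /G'/= /G.
by under eq_bigr do rewrite outer.
Qed.

End Choi.

(** * The generator as a limit of difference quotients *)

Local Open Scope classical_set_scope.

(** The matrix norm is the largest modulus of an entry, so the triangle inequality over matrix units
    gives the bound. *)
Lemma linear_mx_bounded (K : numFieldType) d (L : {linear 'M[K]_d -> 'M[K]_d}) :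
  exists2 M : K, 0 <= M & forall X, `|L X| <= M * `|X|.
Proof.
exists (\sum_i \sum_j `|L (delta_mx i j)|).
  by apply: sumr_ge0 => i _; apply: sumr_ge0.
move=> X; rewrite [in leLHS](matrix_sum_delta X) linear_sum.
apply: (le_trans (ler_norm_sum _ _ _)); rewrite mulr_suml ler_sum// => i _.
rewrite linear_sum (le_trans (ler_norm_sum _ _ _))// mulr_suml ler_sum// => j _.
rewrite linearZ normrZ mulrC ler_wpM2l//.
rewrite [leRHS]/Num.norm/= mx_normE -[leLHS]nngE num_le.
exact: (le_bigmax _ (fun ij => `|X ij.1 ij.2|%:nng) (i, j)).
Qed.

Lemma cvg_norm_le (K : numFieldType) (V : normedModType K) (u : nat -> V)
    (l x : V) (B : K) :
  u @ \oo --> l -> (\forall n \near \oo, `|u n - x| <= B) -> `|l - x| <= B.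
Proof.
move=> ul uB; apply/ler_addgt0Pl => e e0.
have /cvgrPdist_lt /(_ _ e0) ule := ul.
near \oo => n.
rewrite -(subrK (u n) l) -addrA (le_trans (ler_normD _ _))// lerD//.
  by apply: ltW; near: n.
by near: n.
Unshelve. all: by end_near. Qed.

Lemma series_exp_le (R : realType) (m : R) n : 0 <= m ->
  \sum_(0 <= k < n) m ^+ k / k`!%:R <= expR m.
Proof.
move=> m0; apply: nondecreasing_cvgn_le; last exact: is_cvg_series_exp_coeff.
by apply: nondecreasing_series => k _ _; exact: exp_coeff_ge0.
Qed.

Lemma iter_bounded (K : numFieldType) (V : normedModType K) (L : V -> V)
    (M : K) :
  0 <= M -> (forall X, `|L X| <= M * `|X|) ->
  forall k X, `|iter k L X| <= M ^+ k * `|X|.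
Proof.
move=> M0 LM; elim=> [|k IH] X /=; first by rewrite mul1r.
by rewrite exprS -mulrA (le_trans (LM _))// ler_wpM2l.
Qed.

(** The order may be partial, as on complex numbers. Near [F] the function equals its own norm, so
    by continuity of the norm the limit does too. *)
Lemma cvg_ge0 (K : numFieldType) (T : Type) (F : set_system T)
    {FF : ProperFilter F} (u : T -> K) (l : K) :
  u @ F --> l -> (\forall t \near F, 0 <= u t) -> 0 <= l.
Proof.
move=> ul u0; suff -> : l = `|l| by [].
apply: (norm_cvg_unique ul).
apply: cvg_trans (cvg_norm ul); apply: near_eq_cvg.
by apply: filterS u0 => t /ger0_norm.
Qed.

Lemma cvg_conjC (K : numClosedFieldType) (T : Type) (F : set_system T)
    {FF : Filter F} (u : T -> K) (l : K) :
  u @ F --> l -> Num.conj (u t) @[t --> F] --> Num.conj l.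
Proof.
move=> /cvgrPdist_lt ul; apply/cvgrPdist_lt => e /ul; apply: filterS => t.
by rewrite -rmorphB norm_conjC.
Qed.

(** A linear functional is a finite combination of entries, so entrywise convergence suffices. *)
Lemma cvg_scalar (K : numClosedFieldType) (T : Type) (F : set_system T)
    {FF : ProperFilter F} m n (phi : 'M[K]_(m, n) -> K)
    (B : T -> 'M[K]_(m, n)) (B0 : 'M[K]_(m, n)) :
    (forall a X Y, phi (a *: X + Y) = a * phi X + phi Y) ->
    (forall i j, B t i j @[t --> F] --> B0 i j) ->
  phi (B t) @[t --> F] --> phi B0.
Proof.
move=> phi_lin BB0.
pose f : {scalar 'M[K]_(m, n)} :=
  HB.pack phi (GRing.isLinear.Build _ _ _ _ phi phi_lin).
have phiE X : phi X = \sum_i \sum_j X i j * phi (delta_mx i j).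
  rewrite -[LHS]/(f X) [in LHS](matrix_sum_delta X) linear_sum.
  apply: eq_bigr => i _; rewrite linear_sum; apply: eq_bigr => j _.
  by rewrite linearZ.
rewrite phiE; under eq_fun do rewrite phiE.
apply: cvg_big => [|i _]; first exact: add_continuous.
apply: cvg_big => [|j _]; first exact: add_continuous.
exact: cvgMr_tmp.
Qed.

Lemma cvg_hermsymmx (K : numClosedFieldType) (T : Type) (F : set_system T)
    {FF : ProperFilter F} n (B : T -> 'M[K]_n) (B0 : 'M[K]_n) :
    (forall i j, B t i j @[t --> F] --> B0 i j) ->
    (\forall t \near F, B t \is hermsymmx) -> B0 \is hermsymmx.
Proof.
move=> BB0 Bh; apply/hermsymmxP/matrixP => i j; rewrite !mxE.
apply: (norm_cvg_unique _ (BB0 i j)).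
apply: cvg_trans (@cvg_conjC _ _ _ _ _ _ (BB0 j i)).
apply: near_eq_cvg; apply: filterS Bh => t /hermsymmxP {2}<-.
by rewrite !mxE.
Qed.

Lemma cvg_form_ge0 (K : numClosedFieldType) (T : Type) (F : set_system T)
    {FF : ProperFilter F} n (v : 'cV[K]_n) (B : T -> 'M[K]_n) (B0 : 'M[K]_n) :
    (forall i j, B t i j @[t --> F] --> B0 i j) ->
    (\forall t \near F, 0 <= (v^t* *m B t *m v) 0 0) ->
  0 <= (v^t* *m B0 *m v) 0 0.
Proof.
move=> BB0; apply: cvg_ge0.
apply: (cvg_scalar (phi := fun Y => (v^t* *m Y *m v) 0 0) _ BB0) => a X Y.
by rewrite mulmxDr mulmxDl -scalemxAr -scalemxAl !mxE.
Qed.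

Lemma cvg_scalar_eq0 (K : numClosedFieldType) (T : Type) (F : set_system T)
    {FF : ProperFilter F} m n (phi : 'M[K]_(m, n) -> K)
    (B : T -> 'M[K]_(m, n)) (B0 : 'M[K]_(m, n)) :
    (forall a X Y, phi (a *: X + Y) = a * phi X + phi Y) ->
    (forall i j, B t i j @[t --> F] --> B0 i j) ->
    (\forall t \near F, phi (B t) = 0) -> phi B0 = 0.
Proof.
move=> phi_lin BB0 B_0; apply: (norm_cvg_unique (cvg_scalar phi_lin BB0)).
exact: cvg_near_cst.
Qed.

Local Open Scope complex_scope.

Section Generator.
Variables (R : realType) (d : nat).
Local Notation C := R[i].

Lemma is_exp_remainder (L : {linear 'M[C]_d -> 'M[C]_d})
    (Lambda : R -> {linear 'M[C]_d -> 'M[C]_d}) :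
  (forall t : R, 0 <= t -> is_exp L t%:C (Lambda t)) ->
  forall X, exists K : R, forall t, 0 <= t <= 1 ->
    `|Lambda t X - (X + t%:C *: L X)| <= (K * t ^+ 2)%:C.
Proof.
move=> expL X; have [M M0 LM] := linear_mx_bounded L.
have /complex_realP[m ME] := ger0_real M0.
have /complex_realP[c cE] := ger0_real (normr_ge0 X).
have m0 : 0 <= m by rewrite -ler0c -ME.
have c0 : 0 <= c by rewrite -ler0c -cE.
(* The remainder is the exponential series from [k = 2] on. For [t] in [[0, 1]], [t ^+ k] is at most
   [t ^+ 2], and what remains is bounded by [c] times the series of [expR m]. *)
exists (expR m * c) => t /andP[t0 t1].
apply: (cvg_norm_le (expL t t0 X)).
exists 2%N => //= n /= n2.
rewrite /series/= (@big_cat_nat _ _ _ 2)//=.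
rewrite big_ltn// big_ltn// big_geq//= addr0.
rewrite expr0 expr1 !divr1 scale1r.
rewrite [leLHS](_ : _ = `|\sum_(2 <= k < n) (t%:C ^+ k / k`!%:R) *:
    iter k L X|); last first.
  by rewrite [X in X - _]addrC addrK.
apply: (le_trans (ler_norm_sum _ _ _)).
have term_le k : (2 <= k)%N -> `|(t%:C ^+ k / k`!%:R) *: iter k L X|
    <= (t ^+ 2 * c * (m ^+ k / k`!%:R))%:C.
  move=> k2; rewrite normrZ normrM normfV normrX normr_nat ger0_norm ?ler0c//.
  rewrite (le_trans (ler_wpM2l _ (iter_bounded M0 LM _ _)))//.
    by rewrite mulr_ge0// ?exprn_ge0 ?ler0c// invr_ge0 ler0n.
  rewrite ME cE -!rmorphXn/= -(rmorph_nat (real_complex R)).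
  rewrite -fmorphV -!rmorphM/= lecR.
  have -> : t ^+ k / k`!%:R * (m ^+ k * c) = t ^+ k * (c * (m ^+ k / k`!%:R)).
    by rewrite [m ^+ k * c]mulrC mulrAC -!mulrA.
  rewrite -mulrA ler_wpM2r ?ler_wiXn2l//.
  by rewrite !mulr_ge0// ?exprn_ge0// invr_ge0 ler0n.
apply: (@le_trans _ _ (\sum_(2 <= k < n) (t ^+ 2 * c * (m ^+ k / k`!%:R))%:C)).
  by rewrite !big_nat; apply: ler_sum => k /andP[k2 _]; exact: term_le.
rewrite -rmorph_sum lecR -mulr_sumr mulrC [leRHS]mulrAC -mulrA.
have tc0 : 0 <= t ^+ 2 * c by rewrite mulr_ge0// exprn_ge0.
apply: ler_wpM2r => //; apply: le_trans (series_exp_le n m0).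
rewrite [leRHS](@big_cat_nat _ _ _ 2)//= lerDr sumr_ge0// => k _.
by rewrite mulr_ge0 ?exprn_ge0// invr_ge0 ler0n.
Qed.

(* [R[i]] carries its topology only through the cast to [numFieldType]. *)
Lemma generator_cvg (L : {linear 'M[C]_d -> 'M[C]_d})
    (Lambda : R -> {linear 'M[C]_d -> 'M[C]_d}) :
  (forall t : R, 0 <= t -> is_exp L t%:C (Lambda t)) ->
  forall X i j, (t%:C^-1 * (Lambda t X i j - X i j)) @[t --> 0^'+] -->
    (L X i j : (C : numFieldType)).
Proof.
move=> expL X i j; have [K remK] := is_exp_remainder expL X.
pose G t := t%:C^-1 *: (Lambda t X - X).
suff : G t @[t --> 0^'+] --> (L X : 'M[C : numFieldType]_d).
  move=> /(continuous_cvg _ (@coord_continuous _ _ _ i j (L X))).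
  have GE t : t%:C^-1 * (Lambda t X i j - X i j) = G t i j by rewrite !mxE.
  by under [X in _ -> X @ _ --> _]eq_fun do rewrite GE.
apply/cvgrPdist_lt => e e0.
have /complex_realP[r rE] := gtr0_real e0.
have r0 : 0 < r by rewrite -ltcR -rE.
near=> t.
have t0 : 0 < t by near: t; exact: nbhs_right_gt.
have t1 : t <= 1 by near: t; exact: nbhs_right_le.
have tC0 : t%:C != 0 :> C.
  by rewrite -(rmorph0 (real_complex R)) (inj_eq (@complexI R)) gt_eqF.
rewrite distrC.
have -> : G t - L X = t%:C^-1 *: (Lambda t X - (X + t%:C *: L X)).
  by rewrite opprD addrA scalerDr scalerN scalerA mulVf// scale1r.
rewrite normrZ normfV ger0_norm ?ler0c ?ltW// rE.
rewrite [ltLHS]mulrC ltr_pdivrMr ?(ltcR 0)// -rmorphM/=.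
apply: (le_lt_trans (remK t _)); first by rewrite t1 ltW.
rewrite ltcR expr2 mulrA ltr_pM2r//.
(* [K] may be zero or negative; [|K| + 1] is positive, so [t] can be taken below [r / (|K| + 1)]. *)
apply: (@le_lt_trans _ _ ((`|K| + 1) * t)).
  by rewrite ler_wpM2r ?(ltW t0)// (le_trans (ler_norm _))// lerDl.
rewrite mulrC -ltr_pdivlMr ?ltr_wpDl//.
by near: t; apply: nbhs_right_lt; rewrite divr_gt0// ltr_wpDl.
Unshelve. all: by end_near. Qed.

Variables (L : {linear 'M[C]_d -> 'M[C]_d}).
Variable (Lambda : R -> {linear 'M[C]_d -> 'M[C]_d}).
Hypothesis cptp : cptp_semigroup Lambda.
Hypothesis expL : forall t : R, 0 <= t -> is_exp L t%:C (Lambda t).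

(** Complete positivity is applied to the block matrix of matrix units, which is the Choi matrix of
    the identity and has rank at most one. *)
Lemma psd_choi_mx t : 0 <= t -> psdmx (choi_mx (Lambda t)).
Proof.
move=> t0; have [_ _ /(_ t t0) + _] := cptp; apply.
rewrite -[\mxblock_(_, _) _]/(choi_mx id) choi_mx_id; split.
  by apply/hermsymmxP; rewrite ctmx_mul trmxCK.
move=> v; rewrite mulmxA -mulmxA.
have -> : v^t* *m choi_vec C d = ((choi_vec C d)^t* *m v)^t*.
  by rewrite ctmx_mul trmxCK.
by rewrite mxE big_ord1 !mxE mulrC mul_conjC_ge0.
Qed.

Lemma choi_generator_cvg p q :
  (t%:C^-1 *: (choi_mx (Lambda t) - choi_mx id)) p q @[t --> 0^'+] -->
    (choi_mx L p q : (C : numClosedFieldType)).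
Proof.
(* [sig1] gives the block of an index and [sig2] its position inside the block. *)
pose X : 'M[C]_d := delta_mx (tagnat.sig1 p) (tagnat.sig1 q).
pose a := tagnat.sig2 p; pose b := tagnat.sig2 q.
have E t : (t%:C^-1 *: (choi_mx (Lambda t) - choi_mx id)) p q =
    t%:C^-1 * (Lambda t X a b - X a b) by rewrite !mxE.
have -> : choi_mx L p q = L X a b by rewrite mxE.
by under eq_fun do rewrite E; exact: generator_cvg.
Qed.

Lemma choi_generator_herm : choi_mx L \is hermsymmx.
Proof.
apply: (cvg_hermsymmx choi_generator_cvg).
apply: filterS (nbhs_right_gt 0) => t t0.
apply/hermsymmxP; rewrite ctmxZ ctmxB; congr (_ *: (_ - _)).
- by rewrite conj_Creal// rpredV ger0_real// ler0c ltW.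
- by apply/hermsymmxP; have [] := psd_choi_mx (ltW t0).
- by rewrite choi_mx_id ctmx_mul trmxCK.
Qed.

(** On such [v] the subtracted Choi matrix of the identity contributes zero, so the form of each
    difference quotient is nonnegative. *)
Lemma choi_generator_pos (v : 'cV[C]_(\sum_(i < d) d)) :
  (choi_vec C d)^t* *m v = 0 -> 0 <= (v^t* *m choi_mx L *m v) 0 0.
Proof.
move=> v0; apply: (cvg_form_ge0 choi_generator_cvg).
apply: filterS (nbhs_right_gt 0) => t t0.
rewrite -scalemxAr -scalemxAl mxE.
rewrite mulr_ge0 ?[in 0 <= _^-1]invr_ge0 ?ler0c ?(ltW t0)//.
rewrite mulmxBr mulmxBl choi_mx_id -!mulmxA v0 !mulmx0 subr0 mulmxA.
by have [_] := psd_choi_mx (ltW t0); apply.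
Qed.

(** A linear functional constant along the orbit of [X] has zero derivative at time 0. This serves
    both for the trace and for the off-diagonal entries of the image of a block-diagonal
    operator. *)
Lemma generator_scalar_eq0 (phi : 'M[C]_d -> C) X :
    (forall a Y Z, phi (a *: Y + Z) = a * phi Y + phi Z) ->
    (forall t, 0 <= t -> phi (Lambda t X) = phi X) -> phi (L X) = 0.
Proof.
move=> phi_lin phiX.
have phiB Y Z : phi (Y - Z) = phi Y - phi Z.
  by rewrite addrC -scaleN1r phi_lin mulN1r addrC.
have phiZ a Y : phi (a *: Y) = a * phi Y.
  have phi0 : phi 0 = 0 by have := phiB 0 0; rewrite !subrr.
  by rewrite -[a *: Y]addr0 phi_lin phi0 addr0.
have G_cvg i j : (t%:C^-1 *: (Lambda t X - X)) i j @[t --> 0^'+] -->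
    (L X i j : (C : numFieldType)).
  have E t : (t%:C^-1 *: (Lambda t X - X)) i j =
    t%:C^-1 * (Lambda t X i j - X i j) by rewrite !mxE.
  by under eq_fun do rewrite E; exact: generator_cvg.
apply: (cvg_scalar_eq0 phi_lin G_cvg); apply: filterS (nbhs_right_gt 0) => t t0.
by rewrite phiZ phiB phiX ?subrr ?mulr0// ltW.
Qed.

Lemma generator_trace X : \tr (L X) = 0.
Proof.
apply: generator_scalar_eq0 => [a Y Z|t t0]; first by rewrite mxtraceD mxtraceZ.
by have [_ _ _ ->] := cptp.
Qed.

End Generator.

(** * The Lindblad form of the generator and its block structure *)

Lemma generator_kraus (R : realType) d (L : {linear 'M[R[i]]_d -> 'M[R[i]]_d})
    (Lambda : R -> {linear 'M[R[i]]_d -> 'M[R[i]]_d}) :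
    cptp_semigroup Lambda ->
    (forall t : R, 0 <= t -> is_exp L t%:C (Lambda t)) ->
  exists (s : nat) (K : 'I_s -> 'M[R[i]]_d) (A : 'M[R[i]]_d),
    (forall X, L X = \sum_k K k *m X *m (K k)^t* + (A *m X + X *m A^t* )) /\
    \sum_k (K k)^t* *m K k + (A + A^t* ) = 0.
Proof.
move=> cptp expL.
have [s [K [A LE]]] := choi_kraus (choi_generator_herm cptp expL)
  (choi_generator_pos cptp expL).
exists s, K, A; split=> //; apply: mxtrace_mul_eq0 => X.
(* By cyclicity, pairing the claimed operator with [X] under the trace gives the trace of [L X]. *)
rewrite -(generator_trace cptp expL X) LE !mulmxDl mulmx_suml !mxtraceD.
rewrite !raddf_sum /= [\tr (X *m A^t* )]mxtrace_mulC; congr (_ + _).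
by apply: eq_bigr => k _; rewrite [RHS]mxtrace_mulC mulmxA.
Qed.

Theorem theorem2 (R : realType) (d N : nat)
    (V : 'I_N -> {vspace 'cV[R[i]]_d}) (P : 'I_N -> 'M[R[i]]_d)
    (L : {linear 'M[R[i]]_d -> 'M[R[i]]_d})
    (Lambda : R -> {linear 'M[R[i]]_d -> 'M[R[i]]_d}) :
  orthogonal_decomposition V ->
  (forall n, orthogonal_projector (V n) (P n)) ->
  cptp_semigroup Lambda ->
  (forall t : R, 0 <= t -> is_exp L t%:C (Lambda t)) ->
  (forall t : R, 0 <= t ->
     forall X, block_diagonal P X -> block_diagonal P (Lambda t X)) ->
  exists (H : 'M[R[i]]_d) (J : nat) (gamma : 'I_J -> R)
    (jump : 'I_J -> 'M[R[i]]_d),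
    [/\ H \is hermsymmx,
        block_diagonal P H,
        forall j, 0 <= gamma j,
        forall j, exists m n : 'I_N, jump j = P m *m jump j *m P n &
        forall rho : 'M[R[i]]_d, density_matrix rho -> block_diagonal P rho ->
          L rho = - ('i%R *: commutator H rho)
                  + \sum_j (gamma j)%:C *: dissipator (jump j) rho].
Proof.
move=> V_dec P_proj cptp expL Lambda_bd.
have [s [K [A [LE AE]]]] := generator_kraus cptp expL.
pose T : finType := ('I_s * ('I_N * 'I_N))%type.
pose X (x : T) := P x.2.1 *m K x.1 *m P x.2.2.
have sumT (F : T -> 'M[R[i]]_d) :
    \sum_(j < #|T|) F (enum_val j) = \sum_k \sum_m \sum_n F (k, (m, n)).
  under [RHS]eq_bigr => k _ do rewrite (pair_bigA _ (fun m n => F (k, (m, n)))).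
  rewrite (pair_bigA _ (fun k x => F (k, (x.1, x.2)))).
  rewrite -(big_enum_val (A := T) F).
  by apply: eq_bigr => -[k [m n]].
(* Pinching commutes with adjoints, so this is the pinching of [hamiltonian_part A]. *)
have pinchA : block_diagonal P (hamiltonian_part (pinch P A)).
  have [Y [YP AY]] := block_diagonal_pinch P_proj (('i / 2) *: (A - A^t* )).
  exists Y; split=> //; rewrite -AY /hamiltonian_part (pinch_ct P_proj).
  rewrite /pinch -sumrB scaler_sumr; apply: eq_bigr => n _.
  by rewrite -mulmxBl -mulmxBr scalemxAl scalemxAr.
(* All rates are 1: the weights are already absorbed into the [K k]. *)
exists (hamiltonian_part (pinch P A)), #|T|, (fun=> 1).
exists (fun j => X (enum_val j)).
split=> // [|j|rho _ bd_rho].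
- exact: hamiltonian_part_herm.
- exists (enum_val j).2.1, (enum_val j).2.2.
  rewrite /X !mulmxA (projector_idem P_proj).
  by rewrite -!mulmxA (projector_idem P_proj).
(* Each off-diagonal entry vanishes on the whole orbit of [rho], hence so does its derivative at
   time 0. *)
have offdiag m n : m != n -> P m *m L rho *m P n = 0.
  move=> mn; apply/matrixP => i j; rewrite [RHS]mxE.
  apply: (generator_scalar_eq0 expL (phi := fun Y => (P m *m Y *m P n) i j)).
    by move=> a Y Z; rewrite mulmxDr mulmxDl -scalemxAr -scalemxAl !mxE.
  move=> t t0; rewrite !(block_diagonal_offdiag V_dec P_proj)//.
  exact: Lambda_bd.
under eq_bigr do rewrite scale1r.
rewrite sum_dissipator (sumT (fun x => X x *m rho *m (X x)^t* )).
rewrite (sumT (fun x => (X x)^t* *m X x)).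
have gramE : \sum_k \sum_m \sum_n (X (k, (m, n)))^t* *m X (k, (m, n)) =
    pinch P (\sum_k (K k)^t* *m K k).
  rewrite pinch_sum; apply: eq_bigr => k _.
  by rewrite (pinch_gram V_dec P_proj).
rewrite -(offdiag_pinch V_dec P_proj offdiag) LE !pinchD pinch_sum gramE.
rewrite (pinch_mulr V_dec P_proj)// (pinch_mull V_dec P_proj)//.
rewrite -(pinch_ct P_proj).
(* The side condition is the pinching of the trace relation [AE]. *)
rewrite (@drift_hamiltonian _ _ _ (pinch P (\sum_k (K k)^t* *m K k))).
  rewrite addrCA; congr (_ + (_ - _)); apply: eq_bigr => k _.
  by rewrite (pinch_conj V_dec P_proj).
rewrite (pinch_ct P_proj) -!pinchD AE /pinch big1// => n _.
by rewrite mulmx0 mul0mx.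
Qed.
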